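(* Let $\delta$ be a new atomic formula symbol. The logic $\mathsf{QLP}^-(\delta\leftrightarrow\neg(\exists x)x:\delta)_{\emptyset}$, i.e. $\mathsf{QLP}^-$ without the Axiom Necessitation rule, over the language extended by $\delta$, with the single additional axiom $\delta\leftrightarrow\neg(\exists x)x:\delta$, is consistent.
   Context: Fix countably many justification variables, propositional variables, and primitive function symbols of each arity $n\ge0$; a primitive term is $f(x_1,\dots,x_n)$ with $x_i$ variables. Terms of $\mathsf{QLP}^-$: $t::= x\mid f(x_1,\dots,x_n)\mid t\cdot t\mid t+t\mid !t$. Formulas: $A::= p\mid\bot\mid\neg A\mid A\wedge A\mid A\vee A\mid A\rightarrow A\mid t:A\mid(\forall x)A\mid(\exists x)A$, quantifiers over justification variables. Axioms: all propositional tautologies; Q1: $(\forall x)A(x)\rightarrow A(t)$, $t$ free for $x$; Q2: $(\forall x)(A\rightarrow B(x))\rightarrow(A\rightarrow(\forall x)B(x))$, $x$ not free in $A$; Q3: $A(t)\rightarrow(\exists x)A(x)$, $t$ free for $x$; Q4: $(\forall x)(A(x)\rightarrow B)\rightarrow((\exists x)A(x)\rightarrow B)$, $x$ not free in $B$; jK: $s:(A\rightarrow B)\rightarrow(t:A\rightarrow(s\cdot t):B)$; jT: $t:A\rightarrow A$; j4: $t:A\rightarrow !t:t:A$; Sum: $s:A\rightarrow(s+t):A$, $s:A\rightarrow(t+s):A$. Rules: Modus Ponens; Gen: from $A$ infer $(\forall x)A$; Axiom Necessitation: from an axiom instance $A$ infer $f(x_1,\dots,x_n):A$. The subscript $\emptyset$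 means Axiom Necessitation is dropped. All schemes and rules apply to formulas of the extended language. *)

(* Defs.v *)
From mathcomp Require Import all_boot.

Set Implicit Arguments.
Unset Strict Implicit.
Unset Printing Implicit Defensive.

Definition jvar := nat.

(* [TPrim f xs], with [xs : n.-tuple jvar], is the primitive term built with
   the [f]-th function symbol of arity [n]; its arguments are variables only. *)
Inductive term : Type :=
| TVar of jvar
| TPrim (n : nat) (f : nat) (xs : n.-tuple jvar)
| TApp of term & term
| TSum of term & term
| TBang of term.

(* The type of atomic formula symbols is a parameter, so that the language can
   be extended by new symbols. *)
Inductive formula (atom : Type) : Type :=
| FAtom of atom
| FBot
| FNeg of formula atom
| FAnd of formula atom & formula atom
| FOr of formula atom & formula atom
| FImp of formula atom & formula atom
| FJust of term & formula atom
| FAll of jvar & formula atom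
| FEx of jvar & formula atom.

Arguments FBot {atom}.

Definition FIff (atom : Type) (A B : formula atom) : formula atom :=
  FAnd (FImp A B) (FImp B A).

Fixpoint occurs (x : jvar) (s : term) : bool :=
  match s with
  | TVar y => x == y
  | TPrim _ _ xs => x \in xs
  | TApp s1 s2 => occurs x s1 || occurs x s2
  | TSum s1 s2 => occurs x s1 || occurs x s2
  | TBang s1 => occurs x s1
  end.

Fixpoint free_in (atom : Type) (x : jvar) (A : formula atom) : bool :=
  match A with
  | FAtom _ | FBot => false
  | FNeg B => free_in x B
  | FAnd B C | FOr B C | FImp B C => free_in x B || free_in x C
  | FJust s B => occurs x s || free_in x B
  | FAll y B | FEx y B => (x != y) && free_in x B
  end.

Definition omap2 (A B C : Type) (f : A -> B -> C) (a : option A) (b : option B)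
    : option C :=
  obind (fun a' => omap (f a') b) a.

(* Substitution is partial: replacing a variable inside a primitive term yields
   a term only if the replacement is itself a variable. *)
Fixpoint subst_term (x : jvar) (t : term) (s : term) : option term :=
  match s with
  | TVar y => Some (if y == x then t else s)
  | TPrim _ f xs =>
      if x \in xs then
        if t is TVar z then
          Some (TPrim f [tuple of [seq if y == x then z else y | y <- xs]])
        else None
      else Some s
  | TApp s1 s2 => omap2 TApp (subst_term x t s1) (subst_term x t s2)
  | TSum s1 s2 => omap2 TSum (subst_term x t s1) (subst_term x t s2)
  | TBang s1 => omap TBang (subst_term x t s1)
  end.

(* [subst x t A] is A(t), whenever this is a formula. *)
Fixpoint subst (atom : Type) (x : jvar) (t : term) (A : formula atom)
    : option (formula atom) :=
  match A with
  | FAtom _ | FBot => Some A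
  | FNeg B => omap (@FNeg atom) (subst x t B)
  | FAnd B C => omap2 (@FAnd atom) (subst x t B) (subst x t C)
  | FOr B C => omap2 (@FOr atom) (subst x t B) (subst x t C)
  | FImp B C => omap2 (@FImp atom) (subst x t B) (subst x t C)
  | FJust s B => omap2 (@FJust atom) (subst_term x t s) (subst x t B)
  | FAll y B => if y == x then Some A else omap (FAll y) (subst x t B)
  | FEx y B => if y == x then Some A else omap (FEx y) (subst x t B)
  end.

(* [free_for t x A]: no variable of [t] is captured in A(t). *)
Fixpoint free_for (atom : Type) (t : term) (x : jvar) (A : formula atom) : bool :=
  match A with
  | FAtom _ | FBot => true
  | FNeg B | FJust _ B => free_for t x B
  | FAnd B C | FOr B C | FImp B C => free_for t x B && free_for t x C
  | FAll y B | FEx y B =>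
      free_in x A ==> (~~ occurs y t && free_for t x B)
  end.

(* [v] assigns arbitrary truth values to the formulas that are not built by a
   propositional connective; its other values are irrelevant. *)
Fixpoint peval (atom : Type) (v : formula atom -> bool) (A : formula atom) : bool :=
  match A with
  | FBot => false
  | FNeg B => ~~ peval v B
  | FAnd B C => peval v B && peval v C
  | FOr B C => peval v B || peval v C
  | FImp B C => peval v B ==> peval v C
  | FAtom _ | FJust _ _ | FAll _ _ | FEx _ _ => v A
  end.

Definition tautology (atom : Type) (A : formula atom) : Prop :=
  forall v : formula atom -> bool, peval v A.

Inductive QLPm_axiom (atom : Type) : formula atom -> Prop :=
| ax_taut A : tautology A -> QLPm_axiom A
| ax_Q1 x t A At : free_for t x A -> subst x t A = Some At ->
    QLPm_axiom (FImp (FAll x A) At)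
| ax_Q2 x A B : ~~ free_in x A ->
    QLPm_axiom (FImp (FAll x (FImp A B)) (FImp A (FAll x B)))
| ax_Q3 x t A At : free_for t x A -> subst x t A = Some At ->
    QLPm_axiom (FImp At (FEx x A))
| ax_Q4 x A B : ~~ free_in x B ->
    QLPm_axiom (FImp (FAll x (FImp A B)) (FImp (FEx x A) B))
| ax_jK s t A B :
    QLPm_axiom (FImp (FJust s (FImp A B)) (FImp (FJust t A) (FJust (TApp s t) B)))
| ax_jT t A : QLPm_axiom (FImp (FJust t A) A)
| ax_j4 t A : QLPm_axiom (FImp (FJust t A) (FJust (TBang t) (FJust t A)))
| ax_sum_l s t A : QLPm_axiom (FImp (FJust s A) (FJust (TSum s t) A))
| ax_sum_r s t A : QLPm_axiom (FImp (FJust s A) (FJust (TSum t s) A)).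

(* A specification tells which conclusions f(x1, ..., xn):A of Axiom
   Necessitation are allowed; the rule is unrestricted for [full_spec] and is
   dropped for [empty_spec]. *)
Definition specification (atom : Type) : Type :=
  forall n : nat, nat -> n.-tuple jvar -> formula atom -> Prop.

Definition full_spec (atom : Type) : specification atom :=
  fun _ _ _ _ => True.

Definition empty_spec (atom : Type) : specification atom :=
  fun _ _ _ _ => False.

(* Theorems of QLP^- with the additional axioms [X]. *)
Inductive QLPm (atom : Type) (X : formula atom -> Prop) (F : specification atom)
    : formula atom -> Prop :=
| QLPm_ax A : QLPm_axiom A -> QLPm X F A
| QLPm_add A : X A -> QLPm X F A
| QLPm_MP A B : QLPm X F (FImp A B) -> QLPm X F A -> QLPm X F B
| QLPm_gen x A : QLPm X F A -> QLPm X F (FAll x A)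
| QLPm_AN n (f : nat) (xs : n.-tuple jvar) A :
    QLPm_axiom A \/ X A -> F n f xs A -> QLPm X F (FJust (TPrim f xs) A).

Definition consistent (atom : Type) (L : formula atom -> Prop) : Prop :=
  ~ L FBot.

Inductive atom_delta : Type :=
| PropVar of nat
| Delta.

Definition delta : formula atom_delta := FAtom Delta.

(* The formula delta <-> ~ (exists x) x:delta, for a bound variable [x]. *)
Definition delta_axiom (x : jvar) : formula atom_delta :=
  FIff delta (FNeg (FEx x (FJust (TVar x) delta))).

(* Main.v *)
(** Without Axiom Necessitation no formula needs a justification: interpret
    every [t:A] as false, every atom (in particular delta) as true, and erase
    the quantifiers. All axioms and rules preserve truth, and falsum is false. *)
Require Import Defs.
From mathcomp Require Import all_boot.

Fixpoint eval {atom : Type} (A : formula atom) : bool :=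
  match A with
  | FAtom _ => true
  | FBot | FJust _ _ => false
  | FNeg B => ~~ eval B
  | FAnd B C => eval B && eval C
  | FOr B C => eval B || eval C
  | FImp B C => eval B ==> eval C
  | FAll _ B | FEx _ B => eval B
  end.

(** [eval] is thus one of the valuations over which [tautology] quantifies. *)
Lemma peval_eval {atom : Type} (A : formula atom) : peval eval A = eval A.
Proof. by elim: A => //= [B -> | B -> C -> | B -> C -> | B -> C ->]. Qed.

Lemma omap2_Some {A B C : Type} {f : A -> B -> C} {a b c} :
  omap2 f a b = Some c -> exists a' b', [/\ a = Some a', b = Some b' & c = f a' b'].
Proof. by case: a b => [a|] [b|] //= [<-]; exists a, b. Qed.

Lemma omap_Some {A B : Type} {f : A -> B} {a b} :
  omap f a = Some b -> exists2 a', a = Some a' & b = f a'.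
Proof. by case: a => [a|] //= [<-]; exists a. Qed.

(** Substitution alters only terms, and terms occur only inside subformulas [t:B], which are false
    anyway. *)
Lemma eval_subst {atom : Type} {x t} {A At : formula atom} :
  subst x t A = Some At -> eval At = eval A.
Proof.
elim: A At => /= [a | | B IHB | B IHB C IHC | B IHB C IHC | B IHB C IHC
                 | s B _ | y B IHB | y B IHB] At.
- by case=> <-.
- by case=> <-.
- by case/omap_Some=> B' /IHB eB -> /=; rewrite eB.
- by case/omap2_Some=> B' [C' [/IHB eB /IHC eC ->]] /=; rewrite eB eC.
- by case/omap2_Some=> B' [C' [/IHB eB /IHC eC ->]] /=; rewrite eB eC.
- by case/omap2_Some=> B' [C' [/IHB eB /IHC eC ->]] /=; rewrite eB eC.
- by case/omap2_Some=> s' [B' [_ _ ->]].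
- by case: eqP => _; [case=> <- | case/omap_Some=> B' /IHB eB ->].
- by case: eqP => _; [case=> <- | case/omap_Some=> B' /IHB eB ->].
Qed.

Lemma eval_axiom {atom : Type} (A : formula atom) : QLPm_axiom A -> eval A.
Proof.
(* The justification axioms hold by computation, their antecedents being false. With quantifiers
   erased, Q1-Q4 become instances of [b ==> b]. *)
case=> //=.
- by move=> B tB; rewrite -peval_eval.
- by move=> x t B Bt _ /eval_subst ->; apply: implybb.
- by move=> x B C _; apply: implybb.
- by move=> x t B Bt _ /eval_subst ->; apply: implybb.
- by move=> x B C _; apply: implybb.
Qed.

Lemma eval_QLPm {atom : Type} {X : formula atom -> Prop} {A : formula atom} :
  (forall B, X B -> eval B) -> QLPm X (@empty_spec atom) A -> eval A.
Proof.
(* Axiom Necessitation, whose conclusion would be false, is vacuous under [empty_spec]. *)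
move=> evX; elim=> {A} //=.
- exact: eval_axiom.
- by move=> A B _ /implyP AB _ /AB.
Qed.

Theorem theorem24 (x : jvar) :
  consistent (QLPm (fun A => A = delta_axiom x) (@empty_spec atom_delta)).
(* Both sides of [delta_axiom x] are true, since [x:delta] is false. *)
Proof. by move=> pBot; suff: eval (@FBot atom_delta) by []; apply: eval_QLPm pBot => _ ->. Qed.
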